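(* Let $H=T+V$ be as in the context. There exists $C<\infty$, depending only on $C_V$, such that \[\mathbb{E}\big[\operatorname{Im}G(x,x;z)\,\operatorname{Im}S(z)\big]\le C\Big(1+\frac{1}{N\operatorname{Im}z}\Big)^2\] for all $x\in\{1,\dots,N\}$ and all $z$ with $\operatorname{Im}z>0$.
   Context: $H=T+V$ is an $N\times N$ random matrix, where $V=\sum_x V(x)|\delta_x\rangle\langle\delta_x|$ is a random diagonal potential with $\mathbb{P}(V(x)\in I\mid\{V(y)\}_{y\ne x})\le C_V|I|$ for all Borel $I\subset\mathbb{R}$ and all $x$, and $T$ is a Hermitian random matrix independent of $V$. $G(x,y;z)=\langle\delta_y,(H-z)^{-1}\delta_x\rangle$ and $S(z)=\frac1N\operatorname{Tr}(H-z)^{-1}$. *)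

(* Defs.v *)
From HB Require Import structures.
From mathcomp Require Import all_boot all_order all_algebra.
From mathcomp Require Import all_classical all_reals all_analysis.
From mathcomp Require Import complex.
Set Implicit Arguments. Unset Strict Implicit. Unset Printing Implicit Defensive.
Import Order.TTheory GRing.Theory Num.Theory.
Local Open Scope classical_set_scope.
Local Open Scope ring_scope.

Definition sigma_gen {d : measure_display} {Omega : measurableType d} {R : realType}
  {K : Type} (Kset : set K) (X : K -> Omega -> R) : set (set Omega) :=
  <<s [set A | exists k, Kset k /\ exists B : set R, measurable B /\ A = X k @^-1` B] >>.

Definition T_coords {R : realType} {N : nat} {Omega : Type}
  (T : Omega -> 'M[R[i]]_N) : ('I_N * 'I_N * bool) -> Omega -> R :=
  fun k w => if k.2 then complex.Re (T w k.1.1 k.1.2) else complex.Im (T w k.1.1 k.1.2).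

Definition V_coords {R : realType} {N : nat} {Omega : Type}
  (V : Omega -> 'I_N -> R) : 'I_N -> Omega -> R := fun y w => V w y.

Definition indep_sigma {d : measure_display} {Omega : measurableType d} {R : realType}
  (P : probability Omega R) (F1 F2 : set (set Omega)) : Prop :=
  forall A B, F1 A -> F2 B -> P (A `&` B) = (P A * P B)%E.

Definition herm_mx {R : rcfType} {N : nat} (A : 'M[R[i]]_N) : Prop :=
  forall i j, A j i = conjc (A i j).

Definition Hmat {R : realType} {N : nat} (T : 'M[R[i]]_N) (V : 'I_N -> R) : 'M[R[i]]_N :=
  T + diag_mx (\row_i (real_complex R (V i))).

Definition resolvent {R : realType} {N : nat} (H : 'M[R[i]]_N) (z : R[i]) : 'M[R[i]]_N :=
  invmx (H - z%:M).

(* G(x,y;z) = < delta_y, (H - z)^{-1} delta_x > *)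
Definition Gfun {R : realType} {N : nat} (H : 'M[R[i]]_N) (x y : 'I_N) (z : R[i]) : R[i] :=
  resolvent H z y x.

Definition Sfun {R : realType} {N : nat} (H : 'M[R[i]]_N) (z : R[i]) : R[i] :=
  real_complex R (N%:R)^-1 * \tr (resolvent H z).

(* Main.v *)
(** The proof averages over one site at a time, with [T] fixed (by independence and
    Fubini). Let [G0] be the resolvent with [V(x)] replaced by 0. By the rank one formula,
    [Im G(x,x)] is a Poisson kernel in [V(x)] whose parameters do not involve [V(x)], and the
    Ward identity [Im G(x,x) = eta * sum_k |G(x,k)|^2 = eta * sum_k |G(k,x)|^2] bounds
    the change of the trace: [Im Tr G <= h := Im Tr G0 + 1/eta]. As [h] does not involve
    [V(x)], averaging the Poisson kernel gives [E(Im G(x,x) Im Tr G) <= c E(h)]. Averaging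
    over [V(y)] in the same way gives [E(Im G0(y,y)) <= c] for [y != x], while
    [Im G0(x,x) <= 1/eta]; hence [E(h) <= N c + 2/eta], and it remains to divide by [N]. *)

Require Import Defs.
From HB Require Import structures.
From mathcomp Require Import all_boot all_order all_algebra.
From mathcomp Require Import all_classical all_reals all_analysis.
From mathcomp Require Import complex.
From mathcomp Require Import measurable_realfun ring lra.
Import Order.TTheory GRing.Theory Num.Theory.
Local Open Scope classical_set_scope.
Local Open Scope ring_scope.

(** * Real parts, imaginary parts and squared moduli of complex numbers *)

Definition normsq {R : rcfType} (z : R[i]) : R := complex.Re z ^+ 2 + complex.Im z ^+ 2.

Lemma normsq_ge0 {R : rcfType} (z : R[i]) : 0 <= normsq z.
Proof. by rewrite addr_ge0 ?sqr_ge0. Qed.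

Lemma normsq_gt0 {R : rcfType} (z : R[i]) : z != 0 -> 0 < normsq z.
Proof.
move=> z0; rewrite lt_def normsq_ge0 andbT; apply: contra z0.
by rewrite paddr_eq0 ?sqr_ge0// !sqrf_eq0 eq_complex.
Qed.

Lemma cReD {R : rcfType} (a b : R[i]) : complex.Re (a + b) = complex.Re a + complex.Re b.
Proof. by case: a; case: b. Qed.

Lemma cImD {R : rcfType} (a b : R[i]) : complex.Im (a + b) = complex.Im a + complex.Im b.
Proof. by case: a; case: b. Qed.

Lemma cReM {R : rcfType} (a b : R[i]) :
  complex.Re (a * b) = complex.Re a * complex.Re b - complex.Im a * complex.Im b.
Proof. by case: a; case: b. Qed.

Lemma cImM {R : rcfType} (a b : R[i]) :
  complex.Im (a * b) = complex.Re a * complex.Im b + complex.Im a * complex.Re b.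
Proof. by case: a; case: b. Qed.

Lemma normsqM {R : rcfType} (a b : R[i]) : normsq (a * b) = normsq a * normsq b.
Proof. by rewrite /normsq cReM cImM; ring. Qed.

Lemma cRe_sum {R : rcfType} (I : Type) (r : seq I) (p : pred I) (F : I -> R[i]) :
  complex.Re (\sum_(i <- r | p i) F i) = \sum_(i <- r | p i) complex.Re (F i).
Proof. exact: (big_morph _ cReD). Qed.

Lemma cIm_sum {R : rcfType} (I : Type) (r : seq I) (p : pred I) (F : I -> R[i]) :
  complex.Im (\sum_(i <- r | p i) F i) = \sum_(i <- r | p i) complex.Im (F i).
Proof. exact: (big_morph _ cImD). Qed.

(** * Adjoint matrices and the Cauchy-Schwarz inequality *)

Definition adj_mx {R : rcfType} {m n : nat} (A : 'M[R[i]]_(m, n)) : 'M[R[i]]_(n, m) :=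
  map_mx conjc A^T.

Lemma adj_mxM {R : rcfType} {m n p : nat} (A : 'M[R[i]]_(m, n)) (B : 'M[R[i]]_(n, p)) :
  adj_mx (A *m B) = adj_mx B *m adj_mx A.
Proof. by rewrite /adj_mx trmx_mul; exact: map_mxM. Qed.

Lemma adj_mx1 {R : rcfType} {n : nat} : adj_mx (1%:M : 'M[R[i]]_n) = 1%:M.
Proof. by rewrite /adj_mx trmx1; exact: map_mx1. Qed.

Lemma adj_mx_herm {R : rcfType} {n : nat} (H : 'M[R[i]]_n) : herm_mx H -> adj_mx H = H.
Proof. by move=> hH; apply/matrixP => i j; rewrite !mxE -hH. Qed.

Lemma adj_mx_shift {R : rcfType} {n : nat} (H : 'M[R[i]]_n) (z : R[i]) : herm_mx H ->
  adj_mx (H - z%:M) = H - (conjc z)%:M.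
Proof.
move=> hH; rewrite -{2}(adj_mx_herm _ hH) /adj_mx linearB/= map_mxB.
by rewrite tr_scalar_mx map_scalar_mx.
Qed.

Lemma mulc_conj {R : rcfType} (a : R[i]) : conjc a * a = real_complex R (normsq a).
Proof. by case: a => a b; rewrite /normsq; simpc; congr Complex; ring. Qed.

Lemma subc_conj {R : rcfType} (a : R[i]) : a - conjc a = Complex 0 (2 * complex.Im a).
Proof. by case: a => a b; simpc; congr Complex; rewrite /=; ring. Qed.

(** Cauchy-Schwarz without conjugates, for two vectors of equal squared norm. It serves for a row
    and a column of the resolvent, whose norms agree by the Ward identities. *)
Lemma normsq_sum_le {R : rcfType} (I : finType) (a b : I -> R[i]) (S : R) : 0 < S ->
  \sum_k normsq (a k) = S -> \sum_k normsq (b k) = S ->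
  normsq (\sum_k a k * b k) <= S ^+ 2.
Proof.
move=> S0 aS bS; set w := \sum_k a k * b k.
(* AM-GM with weight [1 / S], applied to the real part of [conj w * a k * b k]. *)
have key k : complex.Re (conjc w * (a k * b k)) <=
    2^-1 * (S^-1 * normsq w * normsq (a k)) + 2^-1 * (S * normsq (b k)).
  have -> : S * normsq (b k) = (S * S) * (S^-1 * normsq (b k)).
    by rewrite mulrA mulfK ?gt_eqF.
  have -> : complex.Re (conjc w * (a k * b k)) =
      S * S^-1 * complex.Re (conjc w * (a k * b k)) by rewrite divff ?mul1r ?gt_eqF.
  have Si0 : 0 < S^-1 by rewrite invr_gt0.
  move: (S^-1) Si0 => s s0.
  case: (w) (a k) (b k) => [w1 w2] [a1 a2] [b1 b2]; rewrite /normsq/=.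
  have q1 := mulr_ge0 (ltW s0) (sqr_ge0 (w1 * a1 + w2 * a2 - S * b1)).
  have q2 := mulr_ge0 (ltW s0) (sqr_ge0 (w1 * a2 - w2 * a1 + S * b2)).
  nra.
(* Summing [key] over [k] gives [normsq w] on the left, half of which is then absorbed. *)
have : normsq w <= 2^-1 * normsq w + 2^-1 * S ^+ 2.
  have {1}-> : normsq w = complex.Re (conjc w * w) by rewrite mulc_conj.
  rewrite {2}/w mulr_sumr cRe_sum; apply: le_trans (ler_sum _ (fun k _ => key k)) _.
  rewrite big_split/= -!mulr_sumr aS bS -expr2.
  by rewrite mulrAC mulVf ?mul1r ?gt_eqF.
lra.
Qed.

(** * Resolvents of Hermitian matrices and the Ward identities *)

Section resolvent.
Context {R : realType} {N : nat}.
Variables (H : 'M[R[i]]_N) (z : R[i]).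
Hypotheses (hH : herm_mx H) (z_gt0 : 0 < complex.Im z).
Local Notation G := (resolvent H z).
Local Notation eta := (complex.Im z).

(** For a left null vector [u] of [H - z], the quadratic form [s] of [H] at [u] would equal [z * t]
    with [t = |u|^2 > 0]. But [s] is real, while [z * t] has imaginary part [eta * t > 0]. *)
Lemma resolvent_unit : H - z%:M \in unitmx.
Proof.
rewrite unitmxE unitfE; apply/negP => /det0P[u u0 uH].
have E : u *m H = z *: u.
  by apply/eqP; rewrite -subr_eq0 -mul_mx_scalar -mulmxBr uH.
pose s : R[i] := (u *m H *m adj_mx u) 0 0.
have sc : conjc s = s.
  have : adj_mx (u *m H *m adj_mx u) = u *m H *m adj_mx u.
    rewrite !adj_mxM (adj_mx_herm _ hH) mulmxA; congr (_ *m _ *m _).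
    by apply/matrixP => i j; rewrite !mxE conjcK.
  by move=> /(congr1 (fun M : 'M[R[i]]_1 => M 0 0)); rewrite /s mxE [in X in X = _ -> _]mxE.
pose t : R := \sum_k normsq (u 0 k).
have st : s = z * real_complex R t.
  rewrite /s E -scalemxAl !mxE; congr (_ * _); rewrite rmorph_sum/=.
  by apply: eq_bigr => k _; rewrite !mxE mulrC mulc_conj.
have t0 : 0 < t.
  rewrite lt_def sumr_ge0 ?andbT; last by move=> *; exact: normsq_ge0.
  apply: contra u0; rewrite psumr_eq0; last by move=> *; exact: normsq_ge0.
  move=> /allP u0; apply/eqP/rowP => k; rewrite mxE; apply/eqP.
  by apply: contraTT (u0 k (mem_index_enum _)) => /normsq_gt0; rewrite implyTb lt_def => /andP[].
have := congr1 (@complex.Im R) sc; rewrite st cImM mulr0 add0r.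
case: (z) z_gt0 => x y /= y0; rewrite !mulr0 add0r => e.
have := mulr_gt0 y0 t0; lra.
Qed.

Lemma resolvent_mulV : G *m (H - z%:M) = 1%:M.
Proof. exact: mulVmx resolvent_unit. Qed.

Lemma resolvent_mulmx : (H - z%:M) *m G = 1%:M.
Proof. exact: mulmxV resolvent_unit. Qed.

Lemma adj_mx_shiftB : adj_mx (H - z%:M) - (H - z%:M) = (z - conjc z)%:M.
Proof. by rewrite adj_mx_shift// opprB addrC addrA subrK raddfB. Qed.

(** Both Ward identities come from sandwiching [adj_mx (H - z) - (H - z) = z - conjc z] between [G]
    and its adjoint, which gives [G - adj_mx G]. With the adjoint on the left the diagonal shows
    column sums, with [G] on the left row sums. *)
Lemma ward_col x : complex.Im (G x x) = eta * \sum_k normsq (G k x).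
Proof.
have E : G - adj_mx G = (z - conjc z) *: (adj_mx G *m G).
  have -> : (z - conjc z) *: (adj_mx G *m G) = adj_mx G *m (adj_mx (H - z%:M) - (H - z%:M)) *m G.
    by rewrite adj_mx_shiftB -scalemx1 -scalemxAr mulmx1 -scalemxAl.
  by rewrite mulmxBr mulmxBl -adj_mxM resolvent_mulmx adj_mx1 mul1mx -mulmxA resolvent_mulmx mulmx1.
have := congr1 (fun M : 'M[R[i]]_N => complex.Im (M x x)) E.
rewrite !mxE !subc_conj cImM/= mul0r add0r cRe_sum => e.
suff : 2 * complex.Im (G x x) = 2 * (eta * \sum_k normsq (G k x)) by lra.
rewrite e mulrA; congr (_ * _); apply: eq_bigr => k _.
by rewrite !mxE mulc_conj.
Qed.

Lemma ward_row x : complex.Im (G x x) = eta * \sum_k normsq (G x k).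
Proof.
have E : G - adj_mx G = (z - conjc z) *: (G *m adj_mx G).
  have -> : (z - conjc z) *: (G *m adj_mx G) = G *m (adj_mx (H - z%:M) - (H - z%:M)) *m adj_mx G.
    by rewrite adj_mx_shiftB -scalemx1 -scalemxAr mulmx1 -scalemxAl.
  by rewrite mulmxBr mulmxBl resolvent_mulV mul1mx -mulmxA -adj_mxM resolvent_mulV adj_mx1 mulmx1.
have := congr1 (fun M : 'M[R[i]]_N => complex.Im (M x x)) E.
rewrite !mxE !subc_conj cImM/= mul0r add0r cRe_sum => e.
suff : 2 * complex.Im (G x x) = 2 * (eta * \sum_k normsq (G x k)) by lra.
rewrite e mulrA; congr (_ * _); apply: eq_bigr => k _.
by rewrite !mxE mulrC mulc_conj.
Qed.

(** If the Ward sum vanished, row [x] of [G] would be zero, against the diagonal entry 1 of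
    [G *m (H - z)]. *)
Lemma Im_resolvent_gt0 x : 0 < complex.Im (G x x).
Proof.
rewrite ward_row mulr_gt0// lt_def sumr_ge0 ?andbT; last by move=> *; exact: normsq_ge0.
apply/negP; rewrite psumr_eq0; last by move=> *; exact: normsq_ge0.
move=> /allP G0; have := congr1 (fun M : 'M[R[i]]_N => M x x) resolvent_mulV.
rewrite !mxE eqxx big1 => [/esym/eqP|k _]; first by rewrite oner_eq0.
have /eqP -> : G x k == 0; last by rewrite mul0r.
by apply: contraTT (G0 k (mem_index_enum _)) => /normsq_gt0; rewrite implyTb lt_def => /andP[].
Qed.

(** Keeping only the term [k = x] of the Ward sum leaves [eta * (Im G(x,x))^2 <= Im G(x,x)]. *)
Lemma Im_resolvent_le x : complex.Im (G x x) <= eta^-1.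
Proof.
have g0 := Im_resolvent_gt0 x.
have : eta * complex.Im (G x x) ^+ 2 <= complex.Im (G x x).
  rewrite [leRHS]ward_row ler_pM2l// (bigD1 x)//= ler_wpDr//; last first.
    by rewrite lerDr sqr_ge0.
  by rewrite sumr_ge0// => *; exact: normsq_ge0.
rewrite expr2 mulrA -[leRHS]mul1r ler_pM2r// => e.
by rewrite -[leRHS]mul1r ler_pdivlMr// mulrC.
Qed.

Lemma Im_trace_resolvent_ge0 : 0 <= complex.Im (\tr G).
Proof. by rewrite cIm_sum sumr_ge0// => x _; exact/ltW/Im_resolvent_gt0. Qed.

(** This entry is row [x] times column [x] of [G], and it is what the trace of the rank one
    correction produces. *)
Lemma resolvent_sqr_le x : normsq ((G *m G) x x) <= (complex.Im (G x x) / eta) ^+ 2.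
Proof.
have e0 : eta != 0 by rewrite gt_eqF.
rewrite mxE; apply: normsq_sum_le; first by rewrite divr_gt0// Im_resolvent_gt0.
- by rewrite ward_row mulrC mulKf.
- by rewrite ward_col mulrC mulKf.
Qed.

End resolvent.

(** * Rank one perturbations at a single site *)

Section rank_one.
Context {R : realType} {N : nat}.
Variables (H : 'M[R[i]]_N) (z : R[i]) (x : 'I_N) (v : R).
Hypotheses (hH : herm_mx H) (z_gt0 : 0 < complex.Im z).
Local Notation H' := (H + real_complex R v *: delta_mx x x).
Local Notation G := (resolvent H z).
Local Notation G' := (resolvent H' z).
Local Notation g := (G x x).
Local Notation eta := (complex.Im z).

Lemma herm_rank_one : herm_mx H'.
Proof.
move=> i j; rewrite !mxE hH rmorphD rmorphM; congr (_ + _ * _); first by rewrite /= oppr0.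
by rewrite andbC; case: (_ && _); rewrite /= oppr0.
Qed.

Lemma rank_one_denom_neq0 : 1 + real_complex R v * g != 0.
Proof.
have [->|v0] := eqVneq v 0; first by rewrite mul0r addr0 oner_eq0.
apply/eqP => /(congr1 (@complex.Im R)); rewrite cImD cImM/= mul0r add0r addr0 => /eqP.
by rewrite mulf_eq0 (negbTE v0)/= gt_eqF// Im_resolvent_gt0.
Qed.

(** The resolvent identity [F] expresses [G'] through its own row [x]. At [k = x] it becomes a
    scalar equation, solved by dividing by [1 + v g]. *)
Lemma rank_one_resolvent i j :
  G' i j = G i j - real_complex R v / (1 + real_complex R v * g) * (G i x * G x j).
Proof.
have E : G' = G - real_complex R v *: (G *m delta_mx x x *m G').
  have : G *m (H' - z%:M) *m G' = G.
    by rewrite -mulmxA resolvent_mulmx ?mulmx1//; exact: herm_rank_one.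
  rewrite addrAC mulmxDr resolvent_mulV// mulmxDl mul1mx -scalemxAr -scalemxAl.
  by move=> e; rewrite -{1}e addrK.
have D k l : (G *m delta_mx x x *m G') k l = G k x * G' x l.
  rewrite mxE (bigD1 x)//= big1 ?addr0 => [|m mx].
    rewrite mxE (bigD1 x)//= big1 ?addr0 => [|m mx]; rewrite !mxE ?eqxx ?mulr1//.
    by rewrite (negbTE mx) mulr0.
  by rewrite mxE big1 ?mul0r// => n _; rewrite mxE (negbTE mx) andbF mulr0.
have F k l : G' k l = G k l - real_complex R v * (G k x * G' x l).
  by rewrite {1}E !mxE -D; rewrite !mxE.
have d0 := rank_one_denom_neq0.
have X : G' x j = G x j / (1 + real_complex R v * g).
  by apply: (mulIf d0); rewrite divfK// mulrDr mulr1 {1}(F x j); ring.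
rewrite F X; congr (_ - _); ring.
Qed.

(* With [a + i b = - 1 / g], the diagonal entry of [G'] is [1 / (v - (a + i b))]. *)
Lemma rank_one_Im_diag : complex.Im (G' x x) =
  let b := complex.Im g / normsq g in let a := - (complex.Re g / normsq g) in
  b / ((v - a) ^+ 2 + b ^+ 2).
Proof.
have g0 : 0 < normsq g.
  apply/normsq_gt0/eqP => /(congr1 (@complex.Im R))/eqP.
  by rewrite gt_eqF// Im_resolvent_gt0.
have d0 := normsq_gt0 _ rank_one_denom_neq0.
have -> : G' x x = g / (1 + real_complex R v * g).
  by rewrite rank_one_resolvent; field; exact: rank_one_denom_neq0.
have := Im_resolvent_gt0 _ _ hH z_gt0 x; move: d0 g0.
case: g => p q; rewrite /normsq/= => d0 g0 q0.
have {}d0 : (1 + v * p) ^+ 2 + (v * q) ^+ 2 != 0.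
  by move: d0; rewrite !mul0r !(subr0,addr0,add0r) => /gt_eqF ->.
rewrite !mul0r !(subr0,addr0,add0r).
field; rewrite ?d0 ?gt_eqF//=.
by rewrite ltr_wpDl ?sqr_ge0// exprn_gt0.
Qed.

(** The trace changes by [c] times the diagonal entry of [G *m G]. Since [|1 + v g| >= |v| Im g],
    one has [|c| Im g <= 1], and that entry is at most [Im g / eta] in modulus. The change is thus
    at most [1 / eta], uniformly in [v]. *)
Lemma rank_one_Im_trace : complex.Im (\tr G') <= complex.Im (\tr G) + eta^-1.
Proof.
set c := - (real_complex R v / (1 + real_complex R v * g)).
have -> : \tr G' = \tr G + c * (G *m G) x x.
  rewrite mxE mulr_sumr /mxtrace -big_split/=; apply: eq_bigr => i _.
  by rewrite rank_one_resolvent /c mulNr [G i x * _]mulrC.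
rewrite cImD lerD2l.
have : normsq (c * (G *m G) x x) <= eta^-1 ^+ 2.
  rewrite normsqM.
  have g0 := Im_resolvent_gt0 _ _ hH z_gt0 x.
  have cg : normsq c * complex.Im g ^+ 2 <= 1.
    have -> : normsq c = v ^+ 2 / normsq (1 + real_complex R v * g).
      apply: (mulIf (negbT (gt_eqF (normsq_gt0 _ rank_one_denom_neq0)))).
      rewrite -normsqM divfK ?gt_eqF ?normsq_gt0 ?rank_one_denom_neq0//.
      rewrite /c mulNr divfK ?rank_one_denom_neq0// /normsq/=; ring.
    rewrite mulrAC ler_pdivrMr ?normsq_gt0 ?rank_one_denom_neq0// mul1r.
    rewrite /normsq cImD cImM/= mul0r add0r addr0 -exprMn.
    by rewrite addrC lerDl sqr_ge0.
  apply: le_trans (ler_wpM2l (normsq_ge0 _) (resolvent_sqr_le _ _ hH z_gt0 x)) _.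
  by rewrite exprMn mulrA ler_piMl// sqr_ge0.
move=> h; have e0 : 0 <= eta^-1 by rewrite invr_ge0 ltW.
apply: le_trans (ler_norm _) _; rewrite -(@ler_pXn2r _ 2) ?nnegrE//.
by rewrite real_normK ?num_real// (le_trans _ h)// /normsq lerDr sqr_ge0.
Qed.
End rank_one.

(** * The Poisson kernel of the upper half-plane, without the factor [1 / pi] *)

Definition poisson {R : realType} (a b v : R) : R := b / ((v - a) ^+ 2 + b ^+ 2).

Lemma poisson_ge0 {R : realType} (a b v : R) : 0 <= b -> 0 <= poisson a b v.
Proof. by move=> b0; rewrite divr_ge0// addr_ge0 ?sqr_ge0. Qed.

Lemma measurable_fun_inv {d} {T : measurableType d} {R : realType} (f : T -> R) :
  (forall x, 0 <= f x) -> measurable_fun setT f -> measurable_fun setT (fun x => (f x)^-1).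
Proof.
move=> f0 mf; rewrite (_ : (fun x => _) = @powR R ^~ (-1) \o f).
  by apply: measurableT_comp => //; exact: measurable_powR.
by apply/funext => x /=; rewrite powR_inv1.
Qed.

Lemma measurable_poisson {d} {T : measurableType d} {R : realType} (a b v : T -> R) :
  measurable_fun setT a -> measurable_fun setT b -> measurable_fun setT v ->
  measurable_fun setT (fun x => poisson (a x) (b x) (v x)).
Proof.
move=> ma mb mv; apply: measurable_funM => //; apply: measurable_fun_inv.
  by move=> x; rewrite addr_ge0 ?sqr_ge0.
apply: measurable_funD; apply: measurable_funX => //.
exact: measurable_funB.
Qed.

(** Take the least [k] with [|v - a| < 2^k b]. If [k > 0], minimality gives [|v - a| >= 2^(k-1) b],
    and this shift by one is the source of the factor 4. If [k = 0], the bound [1 / b] suffices. *)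
Lemma poisson_le_dyadic {R : realType} (a b v : R) : 0 < b ->
  exists k : nat, `|v - a| < 2 ^+ k * b /\ poisson a b v <= 4 / b * 4^-1 ^+ k.
Proof.
move=> b0.
have ex : exists k : nat, `|v - a| < 2 ^+ k * b.
  exists (Num.bound (`|v - a| / b)); rewrite -ltr_pdivrMr//.
  apply: lt_le_trans (archi_boundP _) _; first by rewrite divr_ge0// ltW.
  by rewrite -natrX ler_nat ltnW// ltn_expl.
have [k vk kmin] := ex_minnP ex; exists k; split => //.
case: k vk kmin => [|k] vk kmin.
  rewrite expr0 mulr1 /poisson ler_pdivrMr; last by rewrite ltr_wpDl ?sqr_ge0// exprn_gt0.
  rewrite -[leLHS]mul1r mulrDr mulrAC -mulrA [b ^+ 2]expr2 !mulrA divfK ?gt_eqF//.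
  have : 0 <= 4 * ((v - a) ^+ 2 / b) by rewrite mulr_ge0// divr_ge0 ?sqr_ge0// ltW.
  lra.
have {}kmin : 2 ^+ k * b <= `|v - a|.
  by rewrite leNgt; apply/negP => /kmin; rewrite ltnn.
have {}kmin : 4 ^+ k * b ^+ 2 <= (v - a) ^+ 2.
  have -> : 4 ^+ k = (2 ^+ k) ^+ 2 :> R.
    by rewrite -exprM mulnC exprM; congr (_ ^+ _); rewrite expr2; ring.
  by rewrite -exprMn -[leRHS]real_normK ?num_real// lerXn2r ?nnegrE// mulr_ge0 ?exprn_ge0// ltW.
have p4 : 0 < 4 ^+ k :> R by rewrite exprn_gt0.
rewrite exprS (_ : 4 / b * _ = (b * 4 ^+ k)^-1); last by rewrite exprVn; field; rewrite !gt_eqF.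
rewrite /poisson ler_pdivrMr; last by rewrite ltr_wpDl ?sqr_ge0// exprn_gt0.
rewrite ler_pdivlMl ?mulr_gt0//; have := sqr_ge0 b; lra.
Qed.

(** A Harnack inequality: a move of the parameters by an amount comparable to [B] costs only a
    constant. The numerator loses [e]. The denominator loses 3, because
    [(v - A)^2 <= 2 (v - a)^2 + 2 (a - A)^2] and [(a - A)^2 <= B^2 <= b^2]. *)
Lemma poisson_harnack {R : realType} (e a b A B v : R) :
  1 <= e -> 0 < B -> B <= b <= e * B -> A <= a <= A + B ->
  poisson a b v <= 3 * e * poisson A B v.
Proof.
move=> e1 B0 /andP[Bb beB] /andP[Aa aAB].
have b0 : 0 < b by apply: lt_le_trans Bb.
have den (x y : R) : 0 < y -> 0 < (v - x) ^+ 2 + y ^+ 2.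
  by move=> y0; rewrite ltr_wpDl ?sqr_ge0// exprn_gt0.
rewrite /poisson ler_pdivrMr ?den// mulrA mulrAC ler_pdivlMr ?den//.
have h1 : (v - A) ^+ 2 + B ^+ 2 <= 3 * ((v - a) ^+ 2 + b ^+ 2).
  have : (a - A) ^+ 2 <= B ^+ 2 by rewrite -subr_ge0 subr_sqr mulr_ge0//; lra.
  have : B ^+ 2 <= b ^+ 2 by rewrite -subr_ge0 subr_sqr mulr_ge0//; lra.
  have := sqr_ge0 (v - a - (a - A)); nra.
have := den A _ B0; move: h1; set s := _ + B ^+ 2; set t := _ + b ^+ 2 => h1 s0.
apply: (@le_trans _ _ (e * B * s)); first by rewrite ler_pM2r ?s0.
have -> : 3 * e * B * t = e * B * (3 * t) by ring.
by rewrite ler_pM2l// mulr_gt0//; lra.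
Qed.

Lemma measurable_floor_fiber {d} {T : measurableType d} {R : realType} (f : T -> R) (k : int) :
  measurable_fun setT f -> measurable [set w | Num.floor (f w) = k].
Proof.
move=> mf; rewrite (_ : [set w | _] = setT `&` f @^-1` [set` `[k%:~R, (k + 1)%:~R[]).
  by apply: mf => //; exact: measurable_itv.
rewrite setTI; apply/seteqP; split=> w /=; rewrite in_itv/= -floor_eq.
  by move=> ->; rewrite eqxx.
by move/eqP.
Qed.

(** Rounding down to an integer power of Euler's number loses at most one factor of it; this
    discretizes positive parameters. *)
Lemma expR_floor_ln {R : realType} (x : R) : 0 < x ->
  expR (Num.floor (ln x))%:~R <= x <= expR 1 * expR (Num.floor (ln x))%:~R.
Proof.
move=> x0; have /andP[h1 h2] := floor_itv (ln x).
rewrite -{2 3}(lnK x0) -expRD !ler_expR h1/=.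
by move: h2; rewrite intrD => h2; rewrite addrC ltW.
Qed.

(** * Averaging the Poisson kernel under a bounded conditional density *)

Section averaging.
Context {R : realType} {d d' : measure_display} {Omega : measurableType d}
  {Omega' : measurableType d'} (P : probability Omega R).
Variables (p : Omega -> Omega') (X : Omega -> R) (C : R).
Hypotheses (mp : measurable_fun setT p) (mX : measurable_fun setT X) (C_ge0 : 0 <= C).
Hypothesis density : forall (I : set R) (E : set Omega'), measurable I -> measurable E ->
  (P (X @^-1` I `&` p @^-1` E) <= C%:E * lebesgue_measure I * P (p @^-1` E))%E.

(** The kernel is dominated by the layers of height [c k] on the intervals [I k]. Layer [k] has
    length [2 * 2^k b], so the density bound gives it at most [8 C / 2^k] times the measure of the
    cell, and these sum to [16 C]. *)
Lemma poisson_average_cell (a b : R) (E : set Omega') : 0 < b -> measurable E ->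
  (\int[P]_(w in p @^-1` E) (poisson a b (X w))%:E <= (16 * C)%:E * P (p @^-1` E))%E.
Proof.
move=> b0 mE.
have mpE : measurable (p @^-1` E) by rewrite -[_ @^-1` _]setTI; exact: mp.
pose I k : set R := [set` `]a - 2 ^+ k * b, a + 2 ^+ k * b[].
have mI k : measurable (X @^-1` I k).
  by rewrite -[_ @^-1` _]setTI; apply: mX => //; exact: measurable_itv.
pose c k : R := 4 / b * 4^-1 ^+ k.
have c0 k : 0 <= c k by rewrite mulr_ge0 ?exprn_ge0// divr_ge0// ltW.
pose f k (w : Omega) : \bar R := ((c k)%:E * (\1_(X @^-1` I k) w)%:E)%E.
have f0 k w : (0 <= f k w)%E by rewrite mule_ge0// lee_fin.
have mf k : measurable_fun (p @^-1` E) (f k).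
  apply: measurable_funTS; apply: measurable_funeM; apply/measurable_EFinP.
  exact: measurable_indic.
have pw w : ((poisson a b (X w))%:E <= \sum_(k <oo) f k w)%E.
  have [k [Xk ck]] := poisson_le_dyadic a b (X w) b0.
  apply: le_trans (nneseries_lim_ge k.+1 _); last by move=> *; exact: f0.
  have -> : (\sum_(0 <= i < k.+1) f i w = \sum_(0 <= i < k) f i w + (c k)%:E)%E.
    rewrite big_nat_recr//=; congr (_ + _)%E.
    by rewrite /f indicE mem_set ?mule1//= /I /= in_itv/= -ltr_distl.
  by rewrite -[leLHS]add0e leeD ?lee_fin// sume_ge0.
apply: (@le_trans _ _ (\int[P]_(w in p @^-1` E) \sum_(k <oo) f k w)%E).
  apply: ge0_le_integral => //.
  - by move=> w _; rewrite lee_fin poisson_ge0// ltW.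
  - apply: measurable_funTS; apply/measurable_EFinP.
    exact: measurable_poisson.
  - by apply: ge0_emeasurable_sum => // k w _ _; exact: f0.
rewrite integral_nneseries//.
have Pf : (P (p @^-1` E) \is a fin_num)%E by exact: fin_num_measure.
(* The value [8 C / 2^k] is written as [16 C / 2^(k+1)] to match the geometric series that sums to
   its numerator. *)
have term k : (\int[P]_(w in p @^-1` E) f k w <=
    (16 * C * fine (P (p @^-1` E)) / (2 ^ (k + 1))%:R)%:E)%E.
  rewrite ge0_integralZl ?lee_fin//; last first.
    by apply: measurable_funTS; apply/measurable_EFinP; exact: measurable_indic.
  rewrite integral_indic//.
  apply: le_trans (lee_wpmul2l _ (density _ _ _ mE)) _; first by rewrite lee_fin.
    exact: measurable_itv.
  rewrite lebesgue_measure_itv/= lte_fin ltrD2l.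
  have -> : - (2 ^+ k * b) < 2 ^+ k * b.
    by have : 0 < 2 ^+ k * b; [rewrite mulr_gt0 ?exprn_gt0|lra].
  rewrite -[in leLHS](fineK Pf) -EFinB -!EFinM lee_fin le_eqVlt; apply/orP; left; apply/eqP.
  rewrite /c natrX exprD expr1 exprVn.
  have -> : 4 ^+ k = 2 ^+ k * 2 ^+ k :> R by rewrite -exprMn; congr (_ ^+ _); ring.
  have : (2 ^+ k : R) != 0 by rewrite expf_neq0.
  move: (2 ^+ k) => t t0; field.
  by rewrite t0 gt_eqF.
apply: le_trans (lee_nneseries _ (fun k _ => term k)) _.
  by move=> k _ _; apply: integral_ge0.
rewrite -[in leRHS](fineK Pf) -EFinM.
by rewrite (cvg_lim _ (@cvg_geometric_eseries_half R _ 0))// expr0 divr1.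
Qed.

(* The parameters [h], [a], [b] are frozen up to constant factors on countably many
   cells, since the hypothesis only controls products [X @^-1` I `&` p @^-1` E]. *)
Lemma poisson_average (h a b : Omega' -> R) :
  measurable_fun setT h -> measurable_fun setT a -> measurable_fun setT b ->
  (forall w, 0 < h w) -> (forall w, 0 < b w) ->
  (\int[P]_w (h (p w) * poisson (a (p w)) (b (p w)) (X w))%:E
    <= (48 * expR 1 ^+ 2 * C)%:E * \int[P]_w (h (p w))%:E)%E.
Proof.
move=> mh ma mb h0 b0.
(* Cells are indexed by three integers: [h] and [b] are rounded on a logarithmic scale, [a] on a
   grid whose mesh is the rounded [b], as the Harnack inequality requires. *)
pose lh w := Num.floor (ln (h w)); pose lb w := Num.floor (ln (b w)).
pose la w := Num.floor (a w / expR (lb w)%:~R).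
pose c (w : Omega') : int * int * int := (lh w, lb w, la w).
pose E n : set Omega' := (fun w => pickle (c w)) @^-1` [set n].
pose F n : set Omega := p @^-1` (E n).
have mE n : measurable (E n).
  (* A number that encodes no triple has an empty cell. *)
  case Et : (@pickle_inv (int * int * int)%type n) => [[[l k] j]|].
    rewrite (_ : E n = [set w | lh w = l] `&` [set w | lb w = k] `&`
        [set w | Num.floor (a w / expR k%:~R) = j]).
      apply: measurableI; first apply: measurableI.
      - by apply: measurable_floor_fiber; apply: measurableT_comp mh; exact: measurable_ln.
      - by apply: measurable_floor_fiber; apply: measurableT_comp mb; exact: measurable_ln.
      - by apply: measurable_floor_fiber; apply: measurable_funM.
    have -> : n = pickle (l, k, j).
      by have := @pickle_invK (int * int * int)%type n; rewrite Et.
    apply/seteqP; split => w; rewrite /E/=.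
      by move=> /(pcan_inj pickleK_inv)[<- <- <-].
    by move=> [[<- <-] <-].
  rewrite (_ : E n = set0)//; apply/seteqP; split => w //; rewrite /E/= => e.
  by move: Et; rewrite -e pickleK_inv.
have mF n : measurable (F n) by rewrite /F -[_ @^-1` _]setTI; exact: mp.
have FT : \bigcup_n F n = setT.
  by apply/seteqP; split => // w _; exists (pickle (c (p w))).
have tF : trivIset setT F.
  by move=> m n _ _ [w [/= <- <-]].
have mhp : measurable_fun setT (h \o p) by exact: measurableT_comp.
have mf : measurable_fun setT
    (fun w => (h (p w) * poisson (a (p w)) (b (p w)) (X w))%:E).
  apply/measurable_EFinP; apply: measurable_funM => //.
  by apply: measurable_poisson => //; exact: measurableT_comp.
have mh' : measurable_fun setT (fun w => (h (p w))%:E) by exact/measurable_EFinP.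
have f0 w : 0 <= h (p w) * poisson (a (p w)) (b (p w)) (X w).
  by rewrite mulr_ge0 ?poisson_ge0// ltW.
rewrite -FT !ge0_integral_bigcup// ?FT//; last 2 first.
- by move=> w _; rewrite lee_fin ltW.
- by move=> w _; rewrite lee_fin.
have K0 : 0 <= 48 * expR 1 ^+ 2 * C by rewrite !mulr_ge0// exprn_ge0// expR_ge0.
rewrite -nneseriesZl; last first.
  by move=> n _; apply: integral_ge0 => w _; rewrite lee_fin ltW.
apply: lee_nneseries => [n _ _|n _]; first by apply: integral_ge0 => w _; rewrite lee_fin.
case Et : (@pickle_inv (int * int * int)%type n) => [[[l k] j]|]; last first.
  have -> : F n = set0.
    apply/seteqP; split => w //; rewrite /F /E/= => e.
    by move: Et; rewrite -e pickleK_inv.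
  by rewrite !integral_set0 mule0.
have cE w : F n w -> [/\ lh (p w) = l, lb (p w) = k & la (p w) = j].
  by rewrite /F /E/= => e; move: Et; rewrite -e pickleK_inv => -[<- <- <-].
set e : R := expR 1.
have e1 : 1 <= e by rewrite /e -[leLHS]expR0 ler_expR.
(* The rounded values of [h], [b] and [a] on the cell. *)
pose L : R := expR l%:~R; pose B : R := expR k%:~R; pose A := j%:~R * B.
have L0 : 0 < L by exact: expR_gt0.
have B0 : 0 < B by exact: expR_gt0.
(* Rounding [h] costs [e], and the Harnack inequality costs [3 * e]. With the 16 of the single cell
   bound this makes [48 * e ^+ 2]. *)
apply: (@le_trans _ _ (\int[P]_(w in F n) ((e * L * (3 * e))%:E * (poisson A B (X w))%:E))%E).
  apply: ge0_le_integral => //.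
  - by move=> w _; rewrite lee_fin.
  - exact: measurable_funTS.
  - apply: measurable_funTS; apply/measurable_EFinP; apply: measurable_funM => //.
    exact: measurable_poisson.
  - move=> w /cE[hl hk hj]; rewrite -EFinM lee_fin -[leRHS]mulrA.
    have /andP[_ hL] := expR_floor_ln (h (p w)) (h0 _).
    have Hb := expR_floor_ln (b (p w)) (b0 _).
    apply: ler_pM; [exact: ltW|by rewrite poisson_ge0// ltW| |].
      by move: hL; rewrite -/(lh (p w)) hl.
    apply: poisson_harnack => //; first by move: Hb; rewrite -/(lb (p w)) hk.
    have /andP[] := floor_itv (a (p w) / expR (lb (p w))%:~R).
    rewrite -/(la (p w)) hj hk -/B intrD ler_pdivlMr// ltr_pdivrMr// mulrDl mul1r -/A.
    by move=> -> /ltW.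
rewrite ge0_integralZl_EFin//; last 3 first.
- by move=> w _; rewrite lee_fin poisson_ge0// ltW.
- by apply: measurable_funTS; apply/measurable_EFinP; exact: measurable_poisson.
- by rewrite !mulr_ge0// ?ltW//; lra.
have eL0 : 0 <= e * L * (3 * e) by rewrite !mulr_ge0// ?ltW//; lra.
apply: le_trans (lee_wpmul2l _ (poisson_average_cell A B (E n) B0 (mE n))) _.
  by rewrite lee_fin.
rewrite muleA -EFinM (_ : e * L * (3 * e) * (16 * C) = 48 * e ^+ 2 * C * L); last by ring.
rewrite EFinM -muleA; apply: lee_wpmul2l; first by rewrite lee_fin.
(* The rounded value [L] lies below [h] on the cell, so [L] times its probability is at most the
   integral of [h] over it. *)
rewrite -/(F n) -[leLHS]integral_cst//; apply: ge0_le_integral => //.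
- by move=> w _; rewrite lee_fin ltW.
- exact: measurable_funTS.
- move=> w /cE[hl hk hj]; rewrite lee_fin /L -hl.
  by have /andP[] := expR_floor_ln (h (p w)) (h0 _).
Qed.

End averaging.

(** * Freezing one of two independent variables *)

Lemma integral_probability_cst {R : realType} {d} {Omega : measurableType d}
  (P : probability Omega R) (c : R) : (\int[P]_w c%:E = c%:E)%E.
Proof.
rewrite integral_cst// [X in (_ * X)%E](_ : _ = 1%E) ?mule1//.
exact: probability_setT.
Qed.

(** By independence the joint law agrees with the product law on rectangles, hence everywhere.
    Tonelli then integrates the uniform bound [c] against a probability. *)
Lemma indep_integral_le {R : realType} {d d1 d2 : measure_display}
    {Omega : measurableType d} {T1 : measurableType d1} {T2 : measurableType d2}
    (P : probability Omega R) (p1 : {mfun Omega >-> T1}) (p2 : {mfun Omega >-> T2})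
    (f : T1 * T2 -> \bar R) (c : R) :
  (forall A B, measurable A -> measurable B ->
    P (p1 @^-1` A `&` p2 @^-1` B) = (P (p1 @^-1` A) * P (p2 @^-1` B))%E) ->
  measurable_fun setT f -> (forall u, 0 <= f u)%E ->
  (forall u1, \int[P]_w f (u1, p2 w) <= c%:E)%E ->
  (\int[P]_w f (p1 w, p2 w) <= c%:E)%E.
Proof.
move=> indep mf f0 le_c.
have mp : measurable_fun setT (fun w => (p1 w, p2 w)) by exact: measurable_fun_pair.
pose p : {mfun Omega >-> (T1 * T2)%type} := HB.pack (fun w => (p1 w, p2 w))
  (isMeasurableFun.Build _ _ _ _ _ mp).
pose m1 : probability T1 R := distribution P p1.
pose m2 : probability T2 R := distribution P p2.
have -> : (\int[P]_w f (p1 w, p2 w) = \int[distribution P p]_u f u)%E.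
  by rewrite ge0_integral_distribution.
have -> : (\int[distribution P p]_u f u = \int[m1 \x m2]_u f u)%E.
  apply: eq_measure_integral => A mA _; apply/esym.
  by apply: product_measure_unique => // A1 A2 mA1 mA2; exact: indep.
rewrite fubini_tonelli1//.
apply: (@le_trans _ _ (\int[m1]_(u in setT) c%:E)%E).
  apply: ge0_le_integral => //.
  - by move=> u _; exact: integral_ge0.
  - exact: measurable_fun_fubini_tonelli_F.
  - move=> u _; apply: le_trans (le_c u).
    rewrite /fubini_F ge0_integral_distribution//.
    exact: measurableT_comp.
by rewrite integral_probability_cst.
Qed.

(** * Measurability of resolvent entries, through real and imaginary parts *)

Definition cmeasurable {R : realType} {d} {T : measurableType d} (f : T -> R[i]) : Prop :=
  measurable_fun setT (fun w => complex.Re (f w)) /\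
  measurable_fun setT (fun w => complex.Im (f w)).

Section cmeasurable.
Context {R : realType} {d : measure_display} {T : measurableType d}.
Implicit Types f g : T -> R[i].

Lemma cmeasurable_cst (c : R[i]) : cmeasurable (fun _ : T => c).
Proof. by split; exact: measurable_cst. Qed.

Lemma cmeasurable_real (f : T -> R) :
  measurable_fun setT f -> cmeasurable (fun w => real_complex R (f w)).
Proof. by move=> mf; split => //; exact: measurable_cst. Qed.

Lemma cmeasurableD f g : cmeasurable f -> cmeasurable g -> cmeasurable (fun w => f w + g w).
Proof.
move=> [f1 f2] [g1 g2]; split.
  by under eq_fun do rewrite cReD; exact: measurable_funD.
by under eq_fun do rewrite cImD; exact: measurable_funD.
Qed.

Lemma cmeasurableM f g : cmeasurable f -> cmeasurable g -> cmeasurable (fun w => f w * g w).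
Proof.
move=> [f1 f2] [g1 g2]; split.
  by under eq_fun do rewrite cReM; apply: measurable_funB; exact: measurable_funM.
by under eq_fun do rewrite cImM; apply: measurable_funD; exact: measurable_funM.
Qed.

Lemma measurable_normsq f : cmeasurable f -> measurable_fun setT (fun w => normsq (f w)).
Proof. by move=> [f1 f2]; apply: measurable_funD; exact: measurable_funX. Qed.

Lemma cmeasurableV f : cmeasurable f -> cmeasurable (fun w => (f w)^-1).
Proof.
move=> mf; have mi : measurable_fun setT (fun w => (normsq (f w))^-1).
  by apply: measurable_fun_inv; [move=> w; exact: normsq_ge0|exact: measurable_normsq].
case: mf => f1 f2; split.
  have -> : (fun w => complex.Re (f w)^-1) = (fun w => complex.Re (f w) * (normsq (f w))^-1).
    by apply/funext => w; case: (f w).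
  exact: measurable_funM.
have -> : (fun w => complex.Im (f w)^-1) = (fun w => - (complex.Im (f w) * (normsq (f w))^-1)).
  by apply/funext => w; case: (f w).
by apply: measurable_funN; exact: measurable_funM.
Qed.

Lemma cmeasurable_sum (I : Type) (r : seq I) (F : I -> T -> R[i]) :
  (forall i, cmeasurable (F i)) -> cmeasurable (fun w => \sum_(i <- r) F i w).
Proof.
move=> mF; elim: r => [|i r IH].
  by under eq_fun do rewrite big_nil; exact: cmeasurable_cst.
by under eq_fun do rewrite big_cons; exact: cmeasurableD.
Qed.

Lemma cmeasurable_prod (I : Type) (r : seq I) (F : I -> T -> R[i]) :
  (forall i, cmeasurable (F i)) -> cmeasurable (fun w => \prod_(i <- r) F i w).
Proof.
move=> mF; elim: r => [|i r IH].
  by under eq_fun do rewrite big_nil; exact: cmeasurable_cst.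
by under eq_fun do rewrite big_cons; exact: cmeasurableM.
Qed.

Lemma cmeasurable_det (n : nat) (M : T -> 'M[R[i]]_n) :
  (forall i j, cmeasurable (fun w => M w i j)) -> cmeasurable (fun w => \det (M w)).
Proof.
move=> mM; rewrite /determinant; apply: cmeasurable_sum => s.
by apply: cmeasurableM; [exact: cmeasurable_cst|apply: cmeasurable_prod => i].
Qed.

Lemma cmeasurable_trace (n : nat) (M : T -> 'M[R[i]]_n) :
  (forall i j, cmeasurable (fun w => M w i j)) -> cmeasurable (fun w => \tr (M w)).
Proof. by move=> mM; apply: cmeasurable_sum => i; exact: mM. Qed.

(** By Cramer's rule the entries are cofactors divided by the determinant. *)
Lemma cmeasurable_invmx (n : nat) (M : T -> 'M[R[i]]_n) :
  (forall i j, cmeasurable (fun w => M w i j)) -> (forall w, M w \in unitmx) ->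
  forall i j, cmeasurable (fun w => invmx (M w) i j).
Proof.
move=> mM uM i j; under eq_fun do rewrite /invmx uM !mxE.
apply: cmeasurableM; first by apply: cmeasurableV; exact: cmeasurable_det.
rewrite /cofactor; apply: cmeasurableM; first exact: cmeasurable_cst.
by apply: cmeasurable_det => k l; under eq_fun do rewrite !mxE; exact: mM.
Qed.

Lemma cmeasurable_resolvent (n : nat) (H : T -> 'M[R[i]]_n) (z : R[i]) :
  (forall i j, cmeasurable (fun w => H w i j)) -> (forall w, herm_mx (H w)) ->
  0 < complex.Im z -> forall i j, cmeasurable (fun w => resolvent (H w) z i j).
Proof.
move=> mH hH z0; apply: cmeasurable_invmx => [i j|w]; last exact: resolvent_unit.
under eq_fun do rewrite !mxE.
by apply: cmeasurableD; [exact: mH|exact: cmeasurable_cst].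
Qed.

Lemma cmeasurable_Hmat (n : nat) (A : T -> 'M[R[i]]_n) (V : T -> 'I_n -> R) :
  (forall i j, cmeasurable (fun w => A w i j)) ->
  (forall i, measurable_fun setT (fun w => V w i)) ->
  forall i j, cmeasurable (fun w => Hmat (A w) (V w) i j).
Proof.
move=> mA mV i j; under eq_fun do rewrite !mxE.
apply: cmeasurableD; first exact: mA.
case: (i == j) => /=; last exact: cmeasurable_cst.
by under eq_fun do rewrite mulr1n; exact: cmeasurable_real.
Qed.

End cmeasurable.

(** * Hermitian Hamiltonians and sigma-algebras generated by coordinates *)

Lemma herm_Hmat {R : realType} {n : nat} (A : 'M[R[i]]_n) (V : 'I_n -> R) :
  herm_mx A -> herm_mx (Hmat A V).
Proof.
move=> hA i j; rewrite !mxE hA rmorphD eq_sym; congr (_ + _).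
by have [->|_] := eqVneq i j; rewrite ?mulr1n ?mulr0n/= oppr0.
Qed.

(** The generators of [sigma_gen], kept apart so that [Omega] can be viewed as a measurable space
    with that coarser sigma-algebra. *)
Definition gen_system {d : measure_display} {Omega : measurableType d} {R : realType}
  {K : Type} (Kset : set K) (X : K -> Omega -> R) : set (set Omega) :=
  [set A | exists k, Kset k /\ exists B : set R, measurable B /\ A = X k @^-1` B].

Section gen_system.
Context {d : measure_display} {Omega : measurableType d} {R : realType} {K : Type}.
Variables (Kset : set K) (X : K -> Omega -> R).
Local Notation S := (g_sigma_algebraType (gen_system Kset X)).

Lemma measurable_gen_coord k : Kset k -> measurable_fun setT (X k : S -> R).
Proof.
move=> Kk _ B mB; rewrite setTI; apply: sub_gen_smallest.
by exists k; split => //; exists B.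
Qed.

(** Conditioning on coordinates is thereby encoded as the identity map onto the coarser space, in
    the role of [p] in the averaging section. *)
Lemma measurable_to_gen : (forall k, Kset k -> measurable_fun setT (X k)) ->
  measurable_fun setT (fun w : Omega => w : S).
Proof.
move=> mX; apply: (@measurability _ _ _ S _ _ (gen_system Kset X)) => //.
move=> _ [_ [k [Kk [B [mB ->]]]] <-].
exact: mX.
Qed.

End gen_system.

(** * Spectral averaging over the potential, with the kinetic term fixed *)

Definition mask_pot {R : realType} {N : nat} (m : pred 'I_N) (v : 'I_N -> R) : 'I_N -> R :=
  fun j => if m j then v j else 0.

Lemma Hmat_mask {R : realType} {N : nat} (t : 'M[R[i]]_N) (m : pred 'I_N) (v : 'I_N -> R) y :
  m y -> Hmat t (mask_pot m v) =
         Hmat t (mask_pot (predD1 m y) v) + real_complex R (v y) *: delta_mx y y.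
Proof.
move=> my; apply/matrixP => i j; rewrite !mxE -addrA; congr (_ + _).
rewrite /mask_pot /=; have [->|ij] := eqVneq i j; last first.
  rewrite (_ : (i == y) && (j == y) = false) ?mulr0n ?mulr0 ?addr0//.
  by apply: contraNF ij => /andP[/eqP -> /eqP ->].
rewrite !mulr1n; have [->|jy] := eqVneq j y; rewrite /= ?my ?mulr1 ?mulr0 ?addr0 ?add0r//.
Qed.

Section fixed_kinetic.
Context {R : realType} {d : measure_display} {Omega : measurableType d}
  (P : probability Omega R) {N : nat} (V : Omega -> 'I_N -> R) (C : R).
Hypotheses (mV : forall y, measurable_fun setT (V_coords V y)) (C_ge0 : 0 <= C).
Hypothesis density : forall (x : 'I_N) (I : set R), measurable I ->
  forall E, sigma_gen [set y | y != x] (V_coords V) E ->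
    (P ([set w | I (V w x)] `&` E) <= C%:E * lebesgue_measure I * P E)%E.
Variables (t : 'M[R[i]]_N) (z : R[i]).
Hypotheses (ht : herm_mx t) (z_gt0 : 0 < complex.Im z).

Local Notation site_space y :=
  (g_sigma_algebraType (gen_system [set j : 'I_N | j != y] (V_coords V))).
Local Notation G m w := (resolvent (Hmat t (mask_pot m (V w))) z).
Local Notation eta := (complex.Im z).
Local Notation K := (48 * expR 1 ^+ 2).

Lemma cmeasurable_site (m : pred 'I_N) (y : 'I_N) : ~~ m y ->
  forall i j, cmeasurable (fun w : site_space y => G m w i j).
Proof.
move=> my; apply: cmeasurable_resolvent => // [|w]; last exact: herm_Hmat.
apply: cmeasurable_Hmat => [i j|i]; first exact: cmeasurable_cst.
rewrite /mask_pot; case mi : (m i); last exact: measurable_cst.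
apply: (measurable_gen_coord [set j : 'I_N | j != y] (V_coords V) i) => /=.
by apply: contraNneq my => <-.
Qed.

Lemma cmeasurable_full (m : pred 'I_N) : forall i j, cmeasurable (fun w => G m w i j).
Proof.
apply: cmeasurable_resolvent => // [|w]; last exact: herm_Hmat.
apply: cmeasurable_Hmat => [i j|i]; first exact: cmeasurable_cst.
by rewrite /mask_pot; case: (m i); [exact: mV|exact: measurable_cst].
Qed.

(** With [y] removed from the mask, the resolvent gives the Poisson parameters [a] and [b] as
    functions of the other potentials. The weight [h] is such a function too, so averaging over the
    potential at [y] applies. *)
Lemma wegner_weighted (m : pred 'I_N) (y : 'I_N) (h : site_space y -> R) : m y ->
  measurable_fun setT h -> (forall w, 0 < h w) ->
  (\int[P]_w (h w * complex.Im (G m w y y))%:E <= (K * C)%:E * \int[P]_w (h w)%:E)%E.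
Proof.
move=> my mh h0.
pose g (w : site_space y) := G (predD1 m y) w y y.
have mg : cmeasurable g by apply: cmeasurable_site; rewrite /= eqxx.
have g0 w : 0 < complex.Im (g w) by apply: Im_resolvent_gt0 => //; exact: herm_Hmat.
pose a w := - (complex.Re (g w) / normsq (g w)).
pose b w := complex.Im (g w) / normsq (g w).
have mi : measurable_fun setT (fun w => (normsq (g w))^-1).
  by apply: measurable_fun_inv; [move=> w; exact: normsq_ge0|exact: measurable_normsq].
case: (mg) => mg1 mg2.
have ma : measurable_fun setT a by apply: measurable_funN; exact: measurable_funM.
have mb : measurable_fun setT b by exact: measurable_funM.
have b0 w : 0 < b w.
  rewrite divr_gt0//; apply/normsq_gt0/eqP => /(congr1 (@complex.Im R))/eqP.
  by rewrite gt_eqF.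
have mp : measurable_fun setT (fun w : Omega => w : site_space y).
  by apply: measurable_to_gen => k _; exact: mV.
have -> : (\int[P]_w (h w * complex.Im (G m w y y))%:E =
    \int[P]_w (h w * poisson (a w) (b w) (V w y))%:E)%E.
  apply: eq_integral => w _; rewrite (Hmat_mask _ _ _ y)// rank_one_Im_diag//.
  exact: herm_Hmat.
apply: (poisson_average P (fun w : Omega => w : site_space y) (fun w => V w y) C) => //.
- exact: mV.
- by move=> I E mI mE; exact: density.
Qed.

Lemma wegner (m : pred 'I_N) (y : 'I_N) : m y ->
  (\int[P]_w (complex.Im (G m w y y))%:E <= (K * C)%:E)%E.
Proof.
move=> my; have := wegner_weighted m y (fun=> 1) my (measurable_cst _) (fun=> ltr01).
rewrite integral_probability_cst mule1; apply: le_trans.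
by rewrite le_eqVlt; apply/orP; left; apply/eqP; apply: eq_integral => w _; rewrite mul1r.
Qed.

Lemma fixed_kinetic_bound (x : 'I_N) :
  (\int[P]_w (complex.Im (Gfun (Hmat t (V w)) x x z) * complex.Im (Sfun (Hmat t (V w)) z))%:E
   <= (K * C * (K * C + 2 / (N%:R * eta)))%:E)%E.
Proof.
have N0 : 0 < N%:R :> R by rewrite ltr0n (leq_ltn_trans _ (ltn_ord x)).
have K0 : 0 <= K * C by rewrite !mulr_ge0// exprn_ge0// expR_ge0.
pose m := predD1 predT x.
have maskT w : mask_pot predT (V w) = V w by [].
(* By the rank one trace bound, [h] dominates the imaginary part of the full trace while ignoring
   the potential at [x]. *)
pose h (w : site_space x) := complex.Im (\tr (G m w)) + eta^-1.
have mh : measurable_fun setT h.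
  apply: measurable_funD => //; apply: (cmeasurable_trace _ _ _).2.
  by apply: cmeasurable_site; rewrite /= eqxx.
have ei0 : 0 < eta^-1 by rewrite invr_gt0.
have h0 w : 0 < h w.
  by rewrite ltr_wpDl// Im_trace_resolvent_ge0//; exact: herm_Hmat.
(* Each site [y != x] contributes at most [K * C] by averaging. The masked site [x] has only the
   deterministic bound [1 / eta], and a second [1 / eta] comes from the definition of [h]. *)
have int_h : (\int[P]_w (h w)%:E <= (N%:R * (K * C) + 2 * eta^-1)%:E)%E.
  rewrite (_ : (fun w => (h w)%:E) = (fun w => \sum_(y <- enum 'I_N)
      (complex.Im (G m w y y))%:E + (eta^-1)%:E)%E); last first.
    by apply/funext => w; rewrite sumEFin -EFinD /h /mxtrace cIm_sum big_enum.
  have G0 y w : (0 <= (complex.Im (G m w y y))%:E)%E.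
    by rewrite lee_fin ltW// Im_resolvent_gt0//; exact: herm_Hmat.
  have mG y : measurable_fun setT (fun w => (complex.Im (G m w y y))%:E).
    by apply/measurable_EFinP; exact: (cmeasurable_full m y y).2.
  rewrite ge0_integralD//; last 3 first.
  - by move=> w _; apply: sume_ge0.
  - exact: emeasurable_sum.
  - by move=> w _; rewrite lee_fin ltW.
  rewrite ge0_integral_sum// integral_probability_cst.
  have -> : N%:R * (K * C) + 2 * eta^-1 = N%:R * (K * C) + eta^-1 + eta^-1 by ring.
  rewrite [in leRHS]EFinD; apply: leeD2r; rewrite big_enum/= (bigD1 x)//= addeC.
  rewrite EFinD; apply: leeD; last first.
    rewrite -[leRHS](integral_probability_cst P); apply: ge0_le_integral => //.
    - by move=> w _; rewrite lee_fin Im_resolvent_le//; exact: herm_Hmat.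
  apply: (@le_trans _ _ (\sum_(y < N | y != x) (K * C)%:E)%E).
    by apply: lee_sum => y yx; apply: wegner; rewrite /= yx.
  rewrite sumEFin lee_fin sumr_const -[leLHS]mulr_natl ler_wpM2r// ler_nat.
  by rewrite -[leqRHS]card_ord max_card.
have tr_le w : complex.Im (\tr (resolvent (Hmat t (V w)) z)) <= h w.
  rewrite -(maskT w) (Hmat_mask _ _ _ x)//; apply: rank_one_Im_trace => //.
  exact: herm_Hmat.
have Gx0 w : 0 < complex.Im (resolvent (Hmat t (V w)) z x x).
  by apply: Im_resolvent_gt0 => //; exact: herm_Hmat.
have SE w : complex.Im (Sfun (Hmat t (V w)) z) =
    N%:R^-1 * complex.Im (\tr (resolvent (Hmat t (V w)) z)).
  by rewrite /Sfun cImM/= mul0r addr0.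
apply: (@le_trans _ _ (\int[P]_w ((N%:R^-1)%:E *
    (h w * complex.Im (G predT w x x))%:E))%E).
  apply: ge0_le_integral => //.
  - move=> w _; rewrite SE lee_fin; apply: mulr_ge0; first exact/ltW/Gx0.
    by rewrite mulr_ge0 ?invr_ge0// Im_trace_resolvent_ge0//; exact: herm_Hmat.
  - apply/measurable_EFinP; under eq_fun do rewrite SE.
    apply: measurable_funM; first exact: (cmeasurable_full predT x x).2.
    apply: measurable_funM => //; exact: (cmeasurable_trace _ _ (cmeasurable_full predT)).2.
  - apply/measurable_EFinP; apply: measurable_funM => //; apply: measurable_funM => //.
      apply: measurable_funD => //; exact: (cmeasurable_trace _ _ (cmeasurable_full m)).2.
    exact: (cmeasurable_full predT x x).2.
  - move=> w _; rewrite SE -EFinM lee_fin mulrCA ler_pM2l ?invr_gt0//.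
    by rewrite mulrC; exact: (ler_wpM2r (ltW (Gx0 w)) (tr_le w)).
rewrite ge0_integralZl_EFin//; last 2 first.
- by move=> w _; rewrite lee_fin; apply: mulr_ge0; [exact/ltW/h0|exact/ltW/Gx0].
- apply/measurable_EFinP; apply: measurable_funM => //.
    apply: measurable_funD => //; exact: (cmeasurable_trace _ _ (cmeasurable_full m)).2.
  exact: (cmeasurable_full predT x x).2.
(* The average over the potential at [x], with weight [h], comes before the averages over the other
   sites in [int_h]. *)
apply: le_trans (lee_wpmul2l _ (wegner_weighted predT x h isT mh h0)) _.
  by rewrite lee_fin invr_ge0 ltW.
rewrite muleA -EFinM.
apply: le_trans (lee_wpmul2l _ int_h) _; first by rewrite lee_fin mulr_ge0.
rewrite -EFinM lee_fin le_eqVlt; apply/orP; left; apply/eqP.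
by field; rewrite !gt_eqF.
Qed.

End fixed_kinetic.

(** * Averaging over the kinetic term *)

Theorem theorem3p4 (R : realType) (C_V : R) :
  exists C : R,
  forall (N : nat) (d : measure_display) (Omega : measurableType d)
         (P : probability Omega R)
         (T : Omega -> 'M[R[i]]_N) (V : Omega -> 'I_N -> R),
    (* measurability of the random entries *)
    (forall k, measurable_fun setT (T_coords T k)) ->
    (forall y, measurable_fun setT (V_coords V y)) ->
    (* T Hermitian *)
    (forall w, herm_mx (T w)) ->
    (* T independent of V *)
    indep_sigma P (sigma_gen setT (T_coords T)) (sigma_gen setT (V_coords V)) ->
    (* P(V(x) in I | {V(y)}_{y <> x}) <= C_V |I|, written out via the defining
       property of conditional probability *)
    (forall (x : 'I_N) (I : set R), measurable I ->
       forall E, sigma_gen [set y | y != x] (V_coords V) E ->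
         (P ([set w | I (V w x)] `&` E) <= C_V%:E * lebesgue_measure I * P E)%E) ->
    forall (x : 'I_N) (z : R[i]), 0 < complex.Im z ->
      (\int[P]_w ((complex.Im (Gfun (Hmat (T w) (V w)) x x z)
                   * complex.Im (Sfun (Hmat (T w) (V w)) z))%:E)
       <= (C * (1 + (N%:R * complex.Im z)^-1) ^+ 2)%:E)%E.
Proof.
pose a := 48 * expR 1 ^+ 2 * C_V.
(* With [t = 1 / (N eta)], the fixed kinetic bound is [a (a + 2 t)], and
   [a + 2 t <= (a + 2) (1 + t)^2]. *)
exists (a * (a + 2)) => N d Omega P T V mT mV hT indep dens x z z0.
(* Taking both [I] and [E] to be everything, a negative [C_V] would give [1 <= -oo]. *)
have C0 : 0 <= C_V.
  rewrite leNgt; apply/negP => C0.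
  have := dens x setT measurableT setT (@measurableT _ (g_sigma_algebraType (gen_system _ _))).
  have -> : lebesgue_measure [set: R] = +oo%E by rewrite -set_itvNyy lebesgue_measure_itv.
  rewrite (_ : _ `&` _ = setT); last by apply/seteqP; split.
  by rewrite probability_setT mule1 lt0_muley ?lte_fin.
have a0 : 0 <= a by rewrite !mulr_ge0// exprn_ge0// expR_ge0.
pose OT := g_sigma_algebraType (gen_system setT (T_coords T)).
pose OV := g_sigma_algebraType (gen_system setT (V_coords V)).
have mp1 : measurable_fun setT (fun w : Omega => w : OT).
  by apply: measurable_to_gen => k _; exact: mT.
have mp2 : measurable_fun setT (fun w : Omega => w : OV).
  by apply: measurable_to_gen => k _; exact: mV.
pose p1 : {mfun Omega >-> OT} := HB.pack (fun w : Omega => w : OT)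
  (isMeasurableFun.Build _ _ _ _ _ mp1).
pose p2 : {mfun Omega >-> OV} := HB.pack (fun w : Omega => w : OV)
  (isMeasurableFun.Build _ _ _ _ _ mp2).
(* The Hamiltonian is extended to pairs of sample points, one for [T] and one for [V], so that [T]
   can be frozen. *)
pose H (u : OT * OV) := Hmat (T u.1) (V u.2).
pose f (u : OT * OV) : \bar R :=
  (complex.Im (Gfun (H u) x x z) * complex.Im (Sfun (H u) z))%:E.
have hH u : herm_mx (H u) by exact: herm_Hmat.
have mG : forall i j, cmeasurable (fun u => resolvent (H u) z i j).
  apply: cmeasurable_resolvent => //; apply: cmeasurable_Hmat => [i j|i].
    have mTk k : measurable_fun setT (fun u : OT * OV => T_coords T k u.1).
      exact: (measurableT_comp (measurable_gen_coord setT (T_coords T) k I)).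
    by split; [exact: (mTk (i, j, true))|exact: (mTk (i, j, false))].
  exact: (measurableT_comp (measurable_gen_coord setT (V_coords V) i I) measurable_snd).
have N0 : 0 < N%:R :> R by rewrite ltr0n (leq_ltn_trans _ (ltn_ord x)).
apply: (@le_trans _ _ (a * (a + 2 / (N%:R * complex.Im z)))%:E).
  apply: (indep_integral_le P p1 p2 f) => //.
  - apply/measurable_EFinP; apply: measurable_funM; first exact: (mG x x).2.
    rewrite /Sfun; apply: (cmeasurableM _ _ (cmeasurable_cst _) _).2.
    exact: cmeasurable_trace.
  - move=> u; rewrite lee_fin /Sfun cImM/= mul0r addr0 !mulr_ge0 ?invr_ge0//.
      exact/ltW/Im_resolvent_gt0.
    exact: Im_trace_resolvent_ge0.
  - move=> w; exact: (fixed_kinetic_bound P V C_V mV C0 dens (T w) z (hT w) z0 x).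
have := mulr_gt0 N0 z0; rewrite -invr_gt0; move: (_^-1) => t t0.
rewrite lee_fin -mulrA ler_wpM2l//.
nra.
Qed.
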